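(* Let $\mathbb{K}$ be a field of characteristic zero, let $D_E,D_V$ be nonzero $\mathbb{K}$-vector spaces, and let $\phi:D_E\otimes D_V\to D_E\otimes D_V$ be a linear map. For $a\in D_E$ and $x=T\otimes W_T$, $x'=T'\otimes W_{T'}$ in $\mathcal{T}(D_E,D_V)$, define $$x\triangleleft^\phi_a x'=\sum_{v\in V(T')} T\curvearrowright_v T'\otimes \phi_{e_{\mathrm{new}},v}\left(a\otimes W_T\otimes W_{T'}\right),$$ where $a$ is the decoration of the new edge $e_{\mathrm{new}}$ created by the grafting. Then $(\mathcal{T}(D_E,D_V),\triangleleft^\phi)$ is a $D_E$-multiple pre-Lie algebra if and only if $\phi$ is tree-compatible.
   Context: Rooted trees are finite non-planar rooted trees; for a rooted tree $T$, $V(T)$ and $E(T)$ are its vertex and edge sets, and edges are oriented from the root towards the leaves, so each edge $e$ has a source $s(e)$ (the endpoint closer to the root) and a target $t(e)$. For a rooted tree $T$ put $D(T)=\bigotimes_{e\in E(T)}D_e\otimes\bigotimes_{v\in V(T)}D_v$, where each $D_e$ is a copy of $D_E$ and each $D_v$ a copy of $D_V$ (the order of tensor factors is immaterial). Let $\mathcal{T}(D_E,D_V)=\bigoplus_{T} D(T)$ (sum over isomorphism classes of rooted trees); its elements are spans of $T\otimes W_T$ with $W_T=\bigotimes_{e}a_e\otimes\bigotimes_v b_v$, viewed as the tree $T$ with edge $e$ decorated by $a_e\in D_E$ and vertex $v$ decorated by $b_v\in D_V$. For trees $T,T'$ and $v\in V(T')$, $T\curvearrowright_v T'$ is the tree obtained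 by adding a new edge with source $v$ and target the root of $T$. For a linear map $\phi$ on $D_E\otimes D_V$, an edge $e$ and a vertex $v$ of a tree, $\phi_{e,v}$ denotes the endomorphism of the decoration space applying $\phi$ to the factor $D_e\otimes D_v$ and the identity elsewhere. With $\tau$ the flip of $D_E\otimes D_E$, set $\phi_{23}=\mathrm{Id}_{D_E}\otimes\phi$ and $\phi_{13}=(\tau\otimes\mathrm{Id}_{D_V})\circ(\mathrm{Id}_{D_E}\otimes\phi)\circ(\tau\otimes\mathrm{Id}_{D_V})$ on $D_E\otimes D_E\otimes D_V$; $\phi$ is tree-compatible if $\phi_{13}\circ\phi_{23}=\phi_{23}\circ\phi_{13}$. A $D_E$-multiple pre-Lie algebra is a vector space $V$ with a linear map $D_E\otimes V\otimes V\to V$, $a\otimes x\otimes y\mapsto x\triangleleft_a y$, such that for all $a,a'\in D_E$ and $x,y,z\in V$: $x\triangleleft_a(y\triangleleft_{a'}z)-(x\triangleleft_a y)\triangleleft_{a'}z=y\triangleleft_{a'}(x\triangleleft_a z)-(y\triangleleft_{a'}x)\triangleleft_a z$. *)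

(* Defs.v *)
From HB Require Import structures.
From mathcomp Require Import all_boot all_algebra.
From mathcomp Require Import finmap boolp.
From mathcomp.multinomials Require Import monalg.

Set Implicit Arguments.
Unset Strict Implicit.
Unset Printing Implicit Defensive.

Import GRing.Theory.
Local Open Scope ring_scope.
Local Open Scope quotient_scope.

(* Vector spaces given by generators and relations: the quotient of the       *)
(* free vector space {malg K[G]} by the subspace spanned by the set R.        *)
Section Presented.
Context {K : fieldType} {G : choiceType} (R : {malg K[G]} -> Prop).

Inductive spanned : {malg K[G]} -> Prop :=
| spanned0 : spanned 0
| spannedZD c r x : R r -> spanned x -> spanned (c *: r + x).

Lemma spannedD x y : spanned x -> spanned y -> spanned (x + y).
Proof.
move=> + sy; elim=> [|c r z Rr _ IH]; first by rewrite add0r.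
by rewrite -addrA; apply: spannedZD.
Qed.

Lemma spannedZ c x : spanned x -> spanned (c *: x).
Proof.
elim=> [|d r z Rr _ IH]; first by rewrite scaler0; apply: spanned0.
by rewrite scalerDr scalerA; apply: spannedZD.
Qed.

Lemma spannedR r : R r -> spanned r.
Proof.
by move=> Rr; rewrite -[r]scale1r -[_ *: r]addr0; apply/spannedZD/spanned0.
Qed.

Definition span_pred : {pred {malg K[G]}} := fun x => `[< spanned x >].

Lemma span_predP x : reflect (spanned x) (x \in span_pred).
Proof. exact: asboolP. Qed.

Fact span_zmod_closed : zmod_closed span_pred.
Proof.
split=> [|x y /span_predP sx /span_predP sy]; apply/span_predP.
  exact: spanned0.
by apply: spannedD => //; rewrite -scaleN1r; apply: spannedZ.
Qed.
HB.instance Definition _ :=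
  GRing.isZmodClosed.Build {malg K[G]} span_pred span_zmod_closed.

Definition presented := Quotient.quot span_pred.
HB.instance Definition _ := GRing.Zmodule.on presented.

Definition proj (x : {malg K[G]}) : presented := \pi_(Quotient.quot span_pred) x.

Lemma proj_eqP x y : proj x = proj y <-> spanned (x - y).
Proof.
split=> [/eqP|sxy].
  by rewrite -Quotient.idealrBE => /span_predP.
by apply/eqP; rewrite -Quotient.idealrBE; apply/span_predP.
Qed.

Lemma projK (x : presented) : proj (repr x) = x.
Proof. exact: reprK. Qed.

Lemma projD x y : proj (x + y) = proj x + proj y.
Proof. exact: Quotient.pi_add. Qed.

Fact presented_scale_key : unit. Proof. exact: tt. Qed.
Definition presented_scale (c : K) : presented -> presented :=
  locked_with presented_scale_key (fun x => proj (c *: repr x)).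

Lemma projZ c x : proj (c *: x) = presented_scale c (proj x).
Proof.
rewrite /presented_scale unlock; apply/proj_eqP.
by rewrite -scalerBr; apply: spannedZ; apply/proj_eqP; rewrite projK.
Qed.

Fact presented_scaleA c d x :
  presented_scale c (presented_scale d x) = presented_scale (c * d) x.
Proof. by rewrite -[x]projK -!projZ scalerA. Qed.

Fact presented_scale1 : left_id 1 presented_scale.
Proof. by move=> x; rewrite -[x]projK -projZ scale1r. Qed.

Fact presented_scaleDr : right_distributive presented_scale +%R.
Proof.
by move=> c x y; rewrite -[x]projK -[y]projK -projD -!projZ scalerDr projD.
Qed.

Fact presented_scaleDl x :
  {morph presented_scale^~ x : c d / c + d}.
Proof. by move=> c d; rewrite -[x]projK -!projZ scalerDl projD. Qed.

HB.instance Definition _ := GRing.Zmodule_isLmodule.Build K presented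
  presented_scaleA presented_scale1 presented_scaleDr presented_scaleDl.

Fact proj_linear : linear proj.
Proof. by move=> c x y; rewrite projD projZ. Qed.
HB.instance Definition _ := GRing.isLinear.Build K {malg K[G]} presented _ proj
  proj_linear.

Fact gen_key : unit. Proof. exact: tt. Qed.
Definition gen : G -> presented := locked_with gen_key (fun g => proj << g >>).

Lemma genE g : gen g = proj << g >>.
Proof. by rewrite /gen unlock. Qed.

End Presented.

Section Lift.
Context {K : fieldType} {G : choiceType} (W : lmodType K).

Definition mlift (f : G -> W) (x : {malg K[G]}) : W :=
  \sum_(g <- msupp x) x@_g *: f g.

Lemma mliftEw f (d : {fset G}) x :
  (msupp x `<=` d)%fset -> mlift f x = \sum_(g <- d) x@_g *: f g.
Proof.
move=> le; rewrite /mlift (big_fset_incl _ le) // => g _ /mcoeff_outdom ->.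
by rewrite scale0r.
Qed.

Fact mlift_linear f : linear (mlift f).
Proof.
move=> c x y; set d := (msupp x `|` msupp y)%fset.
rewrite !(@mliftEw _ d) ?fsubsetUl ?fsubsetUr //.
  rewrite scaler_sumr -big_split /=; apply: eq_bigr => g _.
  by rewrite mcoeffD mcoeffZ scalerDl scalerA.
apply: fsubset_trans (msuppD_le _ _) _.
by apply: fsetSU; apply: msuppZ_le.
Qed.
HB.instance Definition _ f := GRing.isLinear.Build K {malg K[G]} W _ (mlift f)
  (mlift_linear f).

Lemma mliftU f g : mlift f << g >> = f g.
Proof. by rewrite /mlift msuppU oner_eq0 big_seq_fset1 mcoeffUU scale1r. Qed.

Variable R : {malg K[G]} -> Prop.

Definition respects (f : G -> W) := forall r, R r -> mlift f r = 0.

(* The linear extension of f to the quotient; meaningful when f respects R.   *)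
Fact plift_key : unit. Proof. exact: tt. Qed.
Definition plift (f : G -> W) : presented R -> W :=
  locked_with plift_key (fun x => mlift f (repr x)).

Lemma plift_proj f x : respects f -> plift f (proj R x) = mlift f x.
Proof.
move=> Rf; rewrite /plift unlock; apply/eqP; rewrite -subr_eq0 -linearB; apply/eqP => /=.
have /proj_eqP : proj R (repr (proj R x)) = proj R x by rewrite projK.
elim=> [|c r y /Rf Rr _ IH]; first by rewrite linear0.
by rewrite mlift_linear IH Rr scaler0 addr0.
Qed.

Lemma plift_gen f g : respects f -> plift f (gen R g) = f g.
Proof. by move=> Rf; rewrite genE plift_proj // mliftU. Qed.

Lemma plift_linear f : respects f -> linear (plift f).
Proof.
move=> Rf c x y; rewrite -[x]projK -[y]projK -linearP /=.
by rewrite !plift_proj // linearP.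
Qed.

Lemma presented_ext (f h : presented R -> W) : linear f -> linear h ->
  (forall g, f (gen R g) = h (gen R g)) -> f =1 h.
Proof.
move=> lf lh fh x.
pose F : {linear presented R -> W} := HB.pack f (GRing.isLinear.Build _ _ _ _ f lf).
pose H : {linear presented R -> W} := HB.pack h (GRing.isLinear.Build _ _ _ _ h lh).
rewrite -[f]/(F : _ -> _) -[h]/(H : _ -> _) -[x]projK [repr x]monalgE !linear_sum.
apply: eq_bigr => g _.
have -> : << (repr x)@_g *g g >> = (repr x)@_g *: << g >> :> {malg K[G]}.
  by apply/malgP=> k; rewrite mcoeffZ !mcoeffU mulrnAr mulr1.
by rewrite !linearZ /= -genE [X in _ *: X]fh.
Qed.

End Lift.

Lemma linear_comb (K : fieldType) (V W : lmodType K) (f g : V -> W) (k : K) :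
  linear f -> linear g -> linear (fun u => k *: f u + g u).
Proof.
move=> lf lg c x y /=; rewrite lf lg !scalerDr !scalerA [k * c]mulrC.
by rewrite addrACA.
Qed.

Section Tensor.
Context {K : fieldType} (A B : lmodType K).

Inductive tens_rel : {malg K[(A * B)%type]} -> Prop :=
| tens_relL c a a' b : tens_rel
    (<< (c *: a + a', b) >> - (c *: << (a, b) >> + << (a', b) >>))
| tens_relR c a b b' : tens_rel
    (<< (a, c *: b + b') >> - (c *: << (a, b) >> + << (a, b') >>)).

Definition tensor := presented tens_rel.
HB.instance Definition _ := GRing.Lmodule.on tensor.

Definition tens (a : A) (b : B) : tensor := gen tens_rel (a, b).

Definition bilin (W : lmodType K) (f : A -> B -> W) :=
  (forall b, linear (f^~ b)) /\ (forall a, linear (f a)).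

Lemma tens_bilin : bilin tens.
Proof.
split=> [b|a] c x y; rewrite /tens !genE -linearP; apply/proj_eqP/spannedR.
  exact: tens_relL.
exact: tens_relR.
Qed.

(* The linear map on the tensor product induced by a bilinear f.              *)
Definition tlift (W : lmodType K) (f : A -> B -> W) : tensor -> W :=
  plift (fun p => f p.1 p.2).

Fact tens_respects (W : lmodType K) (f : A -> B -> W) :
  bilin f -> respects tens_rel (fun p => f p.1 p.2).
Proof.
case=> fl fr r [c a a' b|c a b b']; rewrite linearB linearP /= !mliftU /=.
  by rewrite fl subrr.
by rewrite fr subrr.
Qed.

Lemma tlift_tens (W : lmodType K) (f : A -> B -> W) a b :
  bilin f -> tlift f (tens a b) = f a b.
Proof. by move=> bf; rewrite [LHS]plift_gen //; apply: tens_respects. Qed.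

Lemma tlift_linear (W : lmodType K) (f : A -> B -> W) :
  bilin f -> linear (tlift f).
Proof. by move=> bf; apply/plift_linear/tens_respects. Qed.

Lemma tensor_ext (W : lmodType K) (f h : tensor -> W) : linear f -> linear h ->
  (forall a b, f (tens a b) = h (tens a b)) -> f =1 h.
Proof. by move=> lf lh fh; apply: presented_ext => // -[a b]; apply: fh. Qed.

End Tensor.

Section TensorMaps.
Context {K : fieldType}.
Implicit Types A B C D : lmodType K.

Definition tens_map A B C D (f : A -> C) (g : B -> D) :
  tensor A B -> tensor C D := tlift (fun a b => tens (f a) (g b)).

Definition tens_swap A B : tensor A B -> tensor B A :=
  tlift (fun a b => tens b a).

Definition tens_assoc A B C :
    tensor (tensor A B) C -> tensor A (tensor B C) :=
  tlift (fun u c => tlift (fun a b => tens a (tens b c)) u).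

Definition tens_unassoc A B C :
    tensor A (tensor B C) -> tensor (tensor A B) C :=
  tlift (fun a u => tlift (fun b c => tens (tens a b) c) u).

Lemma tens_map_bilin A B C D (f : {linear A -> C}) (g : {linear B -> D}) :
  bilin (fun a b => tens (f a) (g b)).
Proof.
have [tl tr] := @tens_bilin _ C D.
by split=> [b|a] c x y; rewrite linearP ?tl ?tr.
Qed.

Lemma tens_mapE A B C D (f : {linear A -> C}) (g : {linear B -> D}) a b :
  tens_map f g (tens a b) = tens (f a) (g b).
Proof. exact/(tlift_tens _ _ (tens_map_bilin f g)). Qed.

Lemma tens_swap_bilin A B : bilin (fun (a : A) (b : B) => tens b a).
Proof. by have [tl tr] := @tens_bilin _ B A; split. Qed.

Lemma tens_swapE A B (a : A) (b : B) : tens_swap (tens a b) = tens b a.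
Proof. exact/(tlift_tens _ _ (tens_swap_bilin A B)). Qed.

Lemma tens_assoc_bilin A B C :
  (forall c : C, bilin (fun (a : A) (b : B) => tens a (tens b c))) /\
  bilin (fun (u : tensor A B) (c : C) =>
           tlift (fun a b => tens a (tens b c)) u).
Proof.
have [tl tr] := @tens_bilin _ A (tensor B C).
have [tl' tr'] := @tens_bilin _ B C.
have b1 (c : C) : bilin (fun (a : A) (b : B) => tens a (tens b c)).
  by split=> [b|a] k x y; rewrite ?tl ?tl' ?tr.
split=> //; split=> [c|u k x y]; first exact: tlift_linear.
have lx (z : C) : linear (tlift (fun (a : A) (b : B) => tens a (tens b z))).
  exact: tlift_linear.
pose h u := k *: tlift (fun (a : A) (b : B) => tens a (tens b x)) u
            + tlift (fun (a : A) (b : B) => tens a (tens b y)) u.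
apply: (@tensor_ext _ A B _ _ h) => // [|a b]; first exact: linear_comb.
by rewrite /h !tlift_tens // tr' tr.
Qed.

Lemma tens_assocE A B C (a : A) (b : B) (c : C) :
  tens_assoc (tens (tens a b) c) = tens a (tens b c).
Proof.
have [b1 b2] := @tens_assoc_bilin A B C.
by rewrite /tens_assoc tlift_tens // tlift_tens.
Qed.

Lemma tens_unassoc_bilin A B C :
  (forall a : A, bilin (fun (b : B) (c : C) => tens (tens a b) c)) /\
  bilin (fun (a : A) (u : tensor B C) =>
           tlift (fun b c => tens (tens a b) c) u).
Proof.
have [tl tr] := @tens_bilin _ (tensor A B) C.
have [tl' tr'] := @tens_bilin _ A B.
have b1 (a : A) : bilin (fun (b : B) (c : C) => tens (tens a b) c).
  by split=> [c|b] k x y; rewrite ?tr' ?tl ?tr.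
split=> //; split=> [u k x y|a]; last exact: tlift_linear.
have lx (z : A) : linear (tlift (fun (b : B) (c : C) => tens (tens z b) c)).
  exact: tlift_linear.
pose h u := k *: tlift (fun (b : B) (c : C) => tens (tens x b) c) u
            + tlift (fun (b : B) (c : C) => tens (tens y b) c) u.
apply: (@tensor_ext _ B C _ _ h) => // [|b c]; first exact: linear_comb.
by rewrite /h !tlift_tens // tl' tl.
Qed.

Lemma tens_unassocE A B C (a : A) (b : B) (c : C) :
  tens_unassoc (tens a (tens b c)) = tens (tens a b) c.
Proof.
have [b1 b2] := @tens_unassoc_bilin A B C.
by rewrite /tens_unassoc tlift_tens // tlift_tens.
Qed.

End TensorMaps.

Section TreeCompatible.
Context {K : fieldType} {E V : lmodType K}.
Variable phi : {linear tensor E V -> tensor E V}.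

(* E (x) E (x) V is taken to be E (x) (E (x) V); flip12 is tau (x) Id.        *)
Definition flip12 : tensor E (tensor E V) -> tensor E (tensor E V) :=
  @tens_assoc _ E E V \o tens_map (@tens_swap _ E E) (@idfun V)
    \o @tens_unassoc _ E E V.

Definition phi23 : tensor E (tensor E V) -> tensor E (tensor E V) :=
  tens_map (@idfun E) phi.

Definition phi13 : tensor E (tensor E V) -> tensor E (tensor E V) :=
  flip12 \o phi23 \o flip12.

Definition tree_compatible := phi13 \o phi23 =1 phi23 \o phi13.

Lemma flip12E a a' b : flip12 (tens a (tens a' b)) = tens a' (tens a b).
Proof.
pose sw : {linear tensor E E -> tensor E E} := HB.pack (@tens_swap _ E E)
  (GRing.isLinear.Build K _ _ _ (@tens_swap _ E E)
     (tlift_linear (tens_swap_bilin E E))).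
by rewrite /flip12 /= tens_unassocE (tens_mapE sw) /= tens_swapE tens_assocE.
Qed.

End TreeCompatible.

Section Trees.
Context {E V : Type}.

(* Decorated planar rooted trees. Root b is the one-vertex tree decorated by  *)
(* b; Graft a s t is t with one more edge at its root, decorated by a and     *)
(* placed to the left of the others, whose target is the root of s. Thus the  *)
(* tree with root b and branches (a1, s1), ..., (an, sn), from left to right, *)
(* is Graft a1 s1 (... (Graft an sn (Root b))), and the root of Graft a s t   *)
(* is the root of t.                                                          *)
Inductive dtree : Type :=
| Root of V
| Graft of E & dtree & dtree.

Fixpoint vertex (t : dtree) : finType :=
  match t with
  | Root _ => unit
  | Graft _ s t => (vertex s + vertex t)%type
  end.

(* The left summand unit is the edge created by Graft.                        *)
Fixpoint edge (t : dtree) : finType :=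
  match t with
  | Root _ => void
  | Graft _ s t => (unit + (edge s + edge t))%type
  end.

Fixpoint vertex_dec (t : dtree) : vertex t -> V :=
  match t with
  | Root b => fun _ => b
  | Graft _ s t => fun v =>
      match v with inl v => vertex_dec v | inr v => vertex_dec v end
  end.

Fixpoint set_vertex (t : dtree) : vertex t -> V -> dtree :=
  match t with
  | Root _ => fun _ b => Root b
  | Graft a s t => fun v b =>
      match v with
      | inl v => Graft a (set_vertex v b) t
      | inr v => Graft a s (set_vertex v b)
      end
  end.

Fixpoint set_edge (t : dtree) : edge t -> E -> dtree :=
  match t with
  | Root _ => fun e _ => match e with end
  | Graft a0 s t => fun e a =>
      match e with
      | inl _ => Graft a s t
      | inr (inl e) => Graft a0 (set_edge e a) t
      | inr (inr e) => Graft a0 s (set_edge e a)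
      end
  end.

(* The grafting of s on t at the vertex v, the new edge being decorated by a  *)
(* and the decoration of v being replaced by b.                               *)
Fixpoint graft_at (a : E) (s t : dtree) : vertex t -> V -> dtree :=
  match t with
  | Root _ => fun _ b => Graft a s (Root b)
  | Graft a' t1 t2 => fun v b =>
      match v with
      | inl v => Graft a' (graft_at a s v b) t2
      | inr v => Graft a' t1 (graft_at a s v b)
      end
  end.

(* Isomorphism of decorated non-planar rooted trees: equality up to the order *)
(* of the branches at each vertex.                                            *)
Inductive tree_iso : dtree -> dtree -> Prop :=
| iso_root b : tree_iso (Root b) (Root b)
| iso_graft a s s' t t' :
    tree_iso s s' -> tree_iso t t' -> tree_iso (Graft a s t) (Graft a s' t')
| iso_exchange a s a' s' t :
    tree_iso (Graft a s (Graft a' s' t)) (Graft a' s' (Graft a s t))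
| iso_trans t1 t2 t3 :
    tree_iso t1 t2 -> tree_iso t2 t3 -> tree_iso t1 t3.

End Trees.
Arguments dtree : clear implicits.

HB.instance Definition _ (E V : Type) := gen_eqMixin (dtree E V).
HB.instance Definition _ (E V : Type) := gen_choiceMixin (dtree E V).

Section TreeSpace.
Context {K : fieldType} (E V : lmodType K).

(* The class of << t >> is T (x) W_T, where T is the shape of t and W_T the   *)
(* elementary tensor of its decorations. The first two families of relations  *)
(* are those of the tensor product of the decoration spaces; the third one    *)
(* makes the space independent of the choice of a tree in its isomorphism     *)
(* class and of the identification of D(T) with D(T') along T = T'.           *)
Inductive tree_rel : {malg K[dtree E V]} -> Prop :=
| tree_rel_vertex (t : dtree E V) (v : vertex t) c b b' : tree_rel
    (<< set_vertex v (c *: b + b') >>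
       - (c *: << set_vertex v b >> + << set_vertex v b' >>))
| tree_rel_edge (t : dtree E V) (e : edge t) c a a' : tree_rel
    (<< set_edge e (c *: a + a') >>
       - (c *: << set_edge e a >> + << set_edge e a' >>))
| tree_rel_iso (t t' : dtree E V) : tree_iso t t' ->
    tree_rel (<< t >> - << t' >>).

Definition tree_space := presented tree_rel.
HB.instance Definition _ := GRing.Lmodule.on tree_space.

Definition tree_gen (t : dtree E V) : tree_space := gen tree_rel t.

Variable phi : {linear tensor E V -> tensor E V}.

(* The sum runs over the vertices v of t'; applying the induced map to        *)
(* phi (a (x) b_v) amounts to applying phi to the decorations of the new edge *)
(* and of v in the grafting of t on t' at v.                                  *)
Definition graft_sum (a : E) (t t' : dtree E V) : tree_space :=
  \sum_(v : vertex t')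
     tlift (fun a b => tree_gen (graft_at a t v b))
           (phi (tens a (vertex_dec v))).

Definition tree_prelie (a : E) (x x' : tree_space) : tree_space :=
  plift (fun t => plift (graft_sum a t) x') x.

End TreeSpace.

Section MultiplePreLie.
Context {K : fieldType} {E W : lmodType K} (op : E -> W -> W -> W).

Definition trilinear :=
  [/\ forall x y, linear (fun a => op a x y),
      forall a y, linear (fun x => op a x y)
    & forall a x, linear (op a x)].

Definition multiple_prelie := trilinear /\
  forall a a' x y z,
    op a x (op a' y z) - op a' (op a x y) z
      = op a' y (op a x z) - op a (op a' y x) z.

End MultiplePreLie.

Section LinearMaps.
Context {K : fieldType} {V W : lmodType K}.
Implicit Types f g : V -> W.

Lemma linear_zero : linear (fun _ : V => 0 : W).
Proof. by move=> c x y; rewrite scaler0 addr0. Qed.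

Lemma linear_add f g : linear f -> linear g -> linear (fun x => f x + g x).
Proof. by move=> lf lg c x y; rewrite lf lg scalerDr addrACA. Qed.

Lemma linear_scale k f : linear f -> linear (fun x => k *: f x).
Proof.
by move=> lf c x y; rewrite lf scalerDr !scalerA [k * c]mulrC.
Qed.

Lemma linear_bigsum I (r : seq I) (P : pred I) (F : I -> V -> W) :
  (forall i, linear (F i)) -> linear (fun x => \sum_(i <- r | P i) F i x).
Proof.
move=> lF c x y; rewrite scaler_sumr -big_split /=.
by apply: eq_bigr => i _; rewrite lF.
Qed.

Lemma linear_comp (U : lmodType K) f (h : W -> U) :
  linear h -> linear f -> linear (fun x => h (f x)).
Proof. by move=> lh lf c x y; rewrite lf lh. Qed.

End LinearMaps.

Section Lift2.
Context {K : fieldType} {G H : choiceType} {W : lmodType K}.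
Variables (R : {malg K[G]} -> Prop) (S : {malg K[H]} -> Prop).

Lemma gen_respects : respects R (gen R).
Proof.
move=> r Rr; rewrite (_ : mlift _ r = proj R r).
  by rewrite -[RHS](linear0 (proj R)); apply/proj_eqP; rewrite subr0; apply: spannedR.
rewrite [in RHS](monalgE r) linear_sum; apply: eq_bigr => g _.
have -> : << r@_g *g g >> = r@_g *: << g >> :> {malg K[G]}.
  by apply/malgP=> k; rewrite mcoeffZ !mcoeffU mulrnAr mulr1.
by rewrite linearZ /= -genE.
Qed.

Lemma mlift_comp (U : lmodType K) (h : U -> W) (f : G -> U) r :
  linear h -> mlift (fun g => h (f g)) r = h (mlift f r).
Proof.
move=> lh; pose L : {linear U -> W} := HB.pack h (GRing.isLinear.Build _ _ _ _ h lh).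
rewrite -[h]/(L : _ -> _) /mlift linear_sum.
by apply: eq_bigr => g _; rewrite linearZ.
Qed.

Lemma linear0E (U : lmodType K) (h : U -> W) : linear h -> h 0 = 0.
Proof.
by move=> lh; have := lh (-1) 0 0; rewrite scaler0 addr0 scaleN1r addNr.
Qed.

Lemma comp_respects (U : lmodType K) (h : U -> W) (f : G -> U) :
  linear h -> respects R f -> respects R (fun g => h (f g)).
Proof. by move=> lh Rf r Rr; rewrite mlift_comp // Rf // linear0E. Qed.

Variable f : G -> H -> W.
Hypothesis fl : forall h, respects R (f^~ h).
Hypothesis fr : forall g, respects S (f g).

Lemma plift2_respects y : respects R (fun g => @plift _ _ _ S (f g) y).
Proof.
move=> r Rr; have lin : linear (fun y => mlift (fun g => @plift _ _ _ S (f g) y) r).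
  apply: linear_bigsum => g; exact/linear_scale/plift_linear.
apply: (presented_ext lin (@linear_zero _ _ _)) => h.
rewrite -[RHS](fl h Rr) /mlift; apply: eq_bigr => g _.
by rewrite plift_gen.
Qed.

Lemma plift2_linearl y : linear (fun x => @plift _ _ _ R (fun g => @plift _ _ _ S (f g) y) x).
Proof. exact/plift_linear/plift2_respects. Qed.

Lemma plift2_linearr x : linear (fun y => @plift _ _ _ R (fun g => @plift _ _ _ S (f g) y) x).
Proof.
move=> c y z; set F := fun y x => @plift _ _ _ R (fun g => @plift _ _ _ S (f g) y) x.
have lF : linear (fun x => c *: F y x + F z x).
  by apply: linear_comb; apply: plift2_linearl.
apply: (presented_ext (@plift2_linearl _) lF) => g.
by rewrite /F !plift_gen; try exact: plift2_respects; rewrite plift_linear.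
Qed.

Lemma plift2_gen g h : @plift _ _ _ R (fun g => @plift _ _ _ S (f g) (gen S h)) (gen R g) = f g h.
Proof. by rewrite plift_gen ?plift_gen //; apply: plift2_respects. Qed.

End Lift2.

Section TreeSpaceTheory.
Context {K : fieldType} {E V : lmodType K}.
Local Notation T := (tree_space E V).
Local Notation tg := (@tree_gen K E V).
Local Notation R := (@tree_rel K E V).

Lemma tree_respects (W : lmodType K) (f : dtree E V -> W) :
  (forall t (v : vertex t), linear (fun b => f (set_vertex v b))) ->
  (forall t (e : edge t), linear (fun a => f (set_edge e a))) ->
  (forall t t', tree_iso t t' -> f t = f t') -> respects R f.
Proof.
move=> fv fe fi r [t v c b b'|t e c a a'|t t' /fi ftt'].
- by rewrite linearB linearP /= !mliftU fv subrr.
- by rewrite linearB linearP /= !mliftU fe subrr.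
- by rewrite linearB /= !mliftU ftt' subrr.
Qed.

Lemma tree_gen_vertex t (v : vertex t) : linear (fun b => (tg (set_vertex v b))).
Proof.
move=> c b b'; rewrite /tree_gen !genE -linearP; apply/proj_eqP/spannedR.
exact: tree_rel_vertex.
Qed.

Lemma tree_gen_edge t (e : edge t) : linear (fun a => (tg (set_edge e a))).
Proof.
move=> c a a'; rewrite /tree_gen !genE -linearP; apply/proj_eqP/spannedR.
exact: tree_rel_edge.
Qed.

Lemma tree_gen_iso (t t' : dtree E V) : tree_iso t t' -> (tg t) = (tg (t')).
Proof.
by move=> tt'; rewrite /tree_gen !genE; apply/proj_eqP/spannedR/tree_rel_iso.
Qed.

Lemma tree_iso_refl (t : dtree E V) : tree_iso t t.
Proof. by elim: t => [b|a s IHs t IHt]; [apply: iso_root|apply: iso_graft]. Qed.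

Lemma graft_gen_respectsl a t : respects R (fun s => (tg (Graft a s t))).
Proof.
apply: tree_respects => [s v|s e|s s' ss'].
- exact: (@tree_gen_vertex (Graft a s t) (inl v)).
- exact: (@tree_gen_edge (Graft a s t) (inr (inl e))).
- by apply/tree_gen_iso/iso_graft => //; apply: tree_iso_refl.
Qed.

Lemma graft_gen_respectsr a s : respects R (fun t => (tg (Graft a s t))).
Proof.
apply: tree_respects => [t v|t e|t t' tt'].
- exact: (@tree_gen_vertex (Graft a s t) (inr v)).
- exact: (@tree_gen_edge (Graft a s t) (inr (inr e))).
- by apply/tree_gen_iso/iso_graft => //; apply: tree_iso_refl.
Qed.

(* The trilinear extension of Graft.                                          *)
Definition graft_op (a : E) (x y : T) : T :=
  plift (fun s => plift (fun t => (tg (Graft a s t))) y) x.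

Lemma graft_op_gen a s t : graft_op a (tg s) (tg t) = (tg (Graft a s t)).
Proof.
exact: (plift2_gen (graft_gen_respectsl a) (graft_gen_respectsr a)).
Qed.

Lemma graft_op_linearl a y : linear (fun x => graft_op a x y).
Proof.
exact: (plift2_linearl (graft_gen_respectsl a) (graft_gen_respectsr a)).
Qed.

Lemma graft_op_linearr a x : linear (fun y => graft_op a x y).
Proof.
exact: (plift2_linearr (graft_gen_respectsl a) (graft_gen_respectsr a)).
Qed.

Lemma graft_op_linear x y : linear (fun a => graft_op a x y).
Proof.
move=> c a a'; move: x; apply: presented_ext.
- exact: graft_op_linearl.
- exact: (linear_comb _ (graft_op_linearl a y) (graft_op_linearl a' y)).
move=> s; move: y; apply: presented_ext.
- exact: graft_op_linearr.
- exact: (linear_comb _ (graft_op_linearr a _) (graft_op_linearr a' _)).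
move=> t; rewrite !graft_op_gen.
exact: (@tree_gen_edge (Graft 0 s t) (inl tt)).
Qed.

Lemma graft_op_linearD a x y z :
  graft_op a x (y + z) = graft_op a x y + graft_op a x z.
Proof. by have := graft_op_linearr a x 1 y z; rewrite !scale1r. Qed.

Lemma graft_opC a a' x y z :
  graft_op a x (graft_op a' y z) = graft_op a' y (graft_op a x z).
Proof.
have lx u w : linear (fun x => graft_op a x (graft_op a' u w)).
  exact: graft_op_linearl.
move: x; apply: presented_ext => [||s].
- exact: graft_op_linearl.
- by apply: linear_comp (graft_op_linearr a' y) _; apply: graft_op_linearl.
move: y; apply: presented_ext => [||s'].
- by apply: linear_comp (graft_op_linearr a _) _; apply: graft_op_linearl.
- exact: graft_op_linearl.
move: z; apply: presented_ext => [||t].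
- by apply: linear_comp (graft_op_linearr a _) _; apply: graft_op_linearr.
- by apply: linear_comp (graft_op_linearr a' _) _; apply: graft_op_linearr.
rewrite !graft_op_gen; exact/tree_gen_iso/iso_exchange.
Qed.

Lemma graft_at_bilin s t (v : vertex t) :
  bilin (fun a b => (tg (graft_at a s v b))).
Proof.
elim: t v => [b0 _|a0 t1 IH1 t2 IH2 /= [v|v]] /=.
- split=> [b|a]; first exact: (@tree_gen_edge (Graft 0 s (Root b)) (inl tt)).
  exact: (@tree_gen_vertex (Graft a s (Root b0)) (inr tt)).
- have [IHl IHr] := IH1 v; split=> [b|a] c x y; rewrite -!graft_op_gen.
    by rewrite IHl graft_op_linearl.
  by rewrite IHr graft_op_linearl.
- have [IHl IHr] := IH2 v; split=> [b|a] c x y; rewrite -!graft_op_gen.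
    by rewrite IHl graft_op_linearr.
  by rewrite IHr graft_op_linearr.
Qed.

Lemma tlift_comp (A B U W : lmodType K) (h : U -> W) (f : A -> B -> U) u :
  bilin f -> linear h -> tlift (fun a b => h (f a b)) u = h (tlift f u).
Proof.
move=> bf lh; have bhf : bilin (fun a b => h (f a b)).
  by case: bf => fl fr; split=> [b|a]; apply: linear_comp.
move: u; apply: tensor_ext => [||a b].
- exact: tlift_linear.
- exact/linear_comp/tlift_linear.
by rewrite !tlift_tens.
Qed.

Variable phi : {linear tensor E V -> tensor E V}.
Local Notation gs := (graft_sum phi).

Lemma graft_root_bilin (x : T) :
  bilin (fun a b => graft_op a x (tg (Root b))).
Proof.
split=> [b|a]; first exact: graft_op_linear.
apply: linear_comp (graft_op_linearr a x) _.
exact: (@tree_gen_vertex (Root 0) tt).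
Qed.

Lemma graft_sum_root a s b :
  gs a s (Root b) =
    tlift (fun a b => graft_op a (tg s) (tg (Root b))) (phi (tens a b)).
Proof.
rewrite /graft_sum (big_pred1 tt) /=; last by case.
move: (phi _); apply: tensor_ext => [||a' b'].
- exact/tlift_linear/(graft_at_bilin s (tt : vertex (Root b))).
- exact/tlift_linear/graft_root_bilin.
rewrite (tlift_tens _ _ (graft_root_bilin _)) graft_op_gen.
exact: (tlift_tens _ _ (graft_at_bilin s (tt : vertex (Root b)))).
Qed.

Lemma graft_sum_graft a s a' t1 t2 :
  gs a s (Graft a' t1 t2) =
    graft_op a' (gs a s t1) (tg t2) + graft_op a' (tg t1) (gs a s t2).
Proof.
pose F1 : {linear T -> T} := HB.pack (fun x => graft_op a' x (tg t2))
  (GRing.isLinear.Build _ _ _ _ _ (graft_op_linearl a' (tg t2))).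
pose F2 : {linear T -> T} := HB.pack (fun x => graft_op a' (tg t1) x)
  (GRing.isLinear.Build _ _ _ _ _ (graft_op_linearr a' (tg t1))).
rewrite -[graft_op _ _ (tg t2)]/(F1 _) -[graft_op _ (tg t1) _]/(F2 _).
rewrite /graft_sum !linear_sum big_sumType /=; congr (_ + _).
  apply: eq_bigr => v _.
  rewrite -(tlift_comp _ (graft_at_bilin s v) (graft_op_linearl a' (tg t2))).
  by congr tlift; apply/funext => a1; apply/funext => b1; rewrite graft_op_gen.
apply: eq_bigr => v _.
rewrite -(tlift_comp _ (graft_at_bilin s v) (graft_op_linearr a' (tg t1))).
by congr tlift; apply/funext => a1; apply/funext => b1; rewrite graft_op_gen.
Qed.

Fixpoint graft_suml (a : E) (x : T) (t : dtree E V) : T :=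
  match t with
  | Root b => tlift (fun a b => graft_op a x (tg (Root b))) (phi (tens a b))
  | Graft a' t1 t2 => graft_op a' (graft_suml a x t1) (tg t2)
                      + graft_op a' (tg t1) (graft_suml a x t2)
  end.

Lemma graft_suml_linear a t : linear (fun x => graft_suml a x t).
Proof.
elim: t => [b|a' t1 IH1 t2 IH2] /=.
  move: (phi _) => u c x y; move: u; apply: tensor_ext => [||a' b'].
  - exact/tlift_linear/graft_root_bilin.
  - by apply: linear_comb; apply/tlift_linear/graft_root_bilin.
  by rewrite !tlift_tens ?graft_op_linearl //; apply: graft_root_bilin.
apply: linear_add; first exact: linear_comp (graft_op_linearl _ _) IH1.
exact: linear_comp (graft_op_linearr _ _) IH2.
Qed.

Lemma graft_sumlE a s t : gs a s t = graft_suml a (tg s) t.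
Proof.
elim: t => [b|a' t1 IH1 t2 IH2]; first by rewrite graft_sum_root.
by rewrite graft_sum_graft IH1 IH2.
Qed.

Lemma graft_sum_respectsl a t : respects R (fun s => gs a s t).
Proof.
rewrite (_ : (fun s => _) = fun s => graft_suml a (tg s) t); last first.
  by apply/funext => s; rewrite graft_sumlE.
apply: (comp_respects (graft_suml_linear a t)); exact: gen_respects.
Qed.

Lemma graft_sum_respectsr a s : respects R (gs a s).
Proof.
apply: tree_respects => [t v|t e|t t'].
- elim: t v => [b0 v0|a0 t1 IH1 t2 IH2 [v|v]].
  + have lp : linear (fun b => phi (tens a b)).
      by move=> c x y; rewrite (tens_bilin E V).2 linearP.
    move=> c x y /=; rewrite !graft_sum_root lp.
    exact/(tlift_linear (graft_root_bilin _)).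
  + move=> c x y /=; rewrite !graft_sum_graft IH1 tree_gen_vertex.
    by rewrite !graft_op_linearl; rewrite scalerDr addrACA.
  + move=> c x y /=; rewrite !graft_sum_graft IH2 tree_gen_vertex.
    by rewrite !graft_op_linearr; rewrite scalerDr addrACA.
- elim: t e => [b0 []|a0 t1 IH1 t2 IH2 [u|[e|e]]].
  + move=> c x y /=; rewrite !graft_sum_graft.
    by rewrite !graft_op_linear scalerDr addrACA.
  + move=> c x y /=; rewrite !graft_sum_graft IH1 tree_gen_edge.
    by rewrite !graft_op_linearl; rewrite scalerDr addrACA.
  + move=> c x y /=; rewrite !graft_sum_graft IH2 tree_gen_edge.
    by rewrite !graft_op_linearr; rewrite scalerDr addrACA.
elim=> // [a0 s1 s2 t1 t2 /tree_gen_iso es IHs /tree_gen_iso et IHt||t1 t2 t3 _ IH1 _ IH2].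
- by rewrite !graft_sum_graft es et IHs IHt.
- move=> a1 s1 a2 s2 t0; rewrite !graft_sum_graft -!graft_op_gen.
  rewrite !graft_op_linearD.
  by rewrite addrCA graft_opC [X in _ + (_ + X)]graft_opC [X in _ + (X + _)]graft_opC.
- by rewrite IH1 IH2.
Qed.

(* The defining formula of the product.                                       *)
Lemma tree_prelie_gen a t t' :
  tree_prelie phi a (tg t) (tg (t')) = graft_sum phi a t t'.
Proof.
exact: (plift2_gen (graft_sum_respectsl a) (graft_sum_respectsr a)).
Qed.

Lemma tree_prelie_trilinear : trilinear (tree_prelie phi).
Proof.
have ll a y : linear (fun x => tree_prelie phi a x y).
  exact: (plift2_linearl (graft_sum_respectsl a) (graft_sum_respectsr a)).
have lr a x : linear (fun y => tree_prelie phi a x y).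
  exact: (plift2_linearr (graft_sum_respectsl a) (graft_sum_respectsr a)).
split=> // x y c a a'.
move: x; apply: presented_ext => //; first exact: linear_comb.
move=> s; move: y; apply: presented_ext => //; first exact: linear_comb.
move=> t; rewrite !tree_prelie_gen /graft_sum scaler_sumr -big_split /=.
apply: eq_bigr => v _; rewrite (tens_bilin E V).1 linearP.
exact/(tlift_linear (graft_at_bilin _ _)).
Qed.

End TreeSpaceTheory.

(* Main.v *)
Require Import Defs.
From mathcomp Require Import all_boot all_algebra.
From HB Require Import structures.
From mathcomp Require Import boolp classical_sets.

(* Write L a x for z |-> x <|_a z. For the products G a x y that graft x on   *)
(* the root of y by an edge decorated by a, L a x is a derivation, and its    *)
(* value on the one-vertex trees is given by phi. The identity to be proved   *)
(* reads [L a x, L a' y] = L a' (L a x y) - L a (L a' y x); both sides are    *)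
(* derivations, so that it is enough to compare them on a one-vertex tree b,  *)
(* where the difference is the image of (phi13 phi23 - phi23 phi13)           *)
(* (a (x) a' (x) b) by the grafting of x and y on the root. For x a           *)
(* one-vertex tree and y a two-vertex tree this grafting map is injective:    *)
(* linear forms on D_E and D_V give a retraction.                             *)

Set Implicit Arguments.
Unset Strict Implicit.
Unset Printing Implicit Defensive.

Import GRing.Theory.
Local Open Scope ring_scope.

(** Trees are generated from single vertices by [graft_op] ([tree_space_ext]), so [tree_prelie_root]
    and [tree_prelie_graft] determine the product. As functions of the last argument, both sides of
    the pre-Lie identity obey the recursion [tree_prelie2_graft]. On a single vertex they are the
    images of [phi13 phi23] and [phi23 phi13] under [graft_root2] ([tree_prelie2_root],
    [tree_prelie2_rootC]). Tree-compatibility thus gives the identity by induction, and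
    [graft_root2_inj] gives the converse. *)

Section LinearForm.
Local Open Scope classical_set_scope.

(** * Linear forms from Zorn's lemma *)

Lemma exists_linear_form (K : fieldType) (V : lmodType K) (b : V) : b != 0 ->
  exists2 f : V -> K, linear (f : V -> K^o) & f b = 1.
Proof.
(* A maximal subspace M that does not contain b is a complement of K b.       *)
move=> b0.
pose P (A : set V) :=
  (forall c x y, A x -> A y -> A (c *: x + y)) /\ ~ A b.
have [|M [[Mlin Mb] Mmax]] := @Zorn_bigcup V P.
  move=> F FP Ftot; split=> [c x y [A FA Ax] [B FB By]|[A FA Ab]]; last first.
    by have [_] := FP _ FA; apply.
  have [AB|BA] := Ftot _ _ FA FB.
    by exists B => //; have [lin _] := FP _ FB; apply: lin => //; apply: AB.
  by exists A => //; have [lin _] := FP _ FA; apply: lin => //; apply: BA.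
(* [P] holds of the empty set, as the empty chain requires; maximality against {0} excludes an empty
   [M]. *)
have M0 : M 0.
  have [[x Mx]|Me] := pselect (exists x, M x).
    by have := Mlin (-1) _ _ Mx Mx; rewrite scaleN1r addNr.
  case: (Mmax [set 0]).
    split=> [x Mx|le]; first by case: Me; exists x.
    by apply: Me; exists 0; apply: le.
  split=> [c x y -> ->|/= /eqP]; first by rewrite /= scaler0 addr0.
  by rewrite (negPf b0).
have MZ c x : M x -> M (c *: x) by move=> Mx; rewrite -[_ *: _]addr0; apply: Mlin.
have MD x y : M x -> M y -> M (x + y) by rewrite -{2}[x]scale1r; apply: Mlin.
have MB x y : M x -> M y -> M (x - y).
  by move=> Mx My; apply: MD => //; rewrite -scaleN1r; apply: MZ.
have coord_ex v : exists c, M (v - c *: b).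
  have [Mv|Mv] := pselect (M v); first by exists 0; rewrite scale0r subr0.
  (* [B] is M + K v. By maximality it contains [b], with a nonzero coefficient on [v] since [b] is
     not in [M]; hence [v] is a multiple of [b] modulo [M]. *)
  pose B : set V := [set w | exists c, M (w - c *: v)].
  have : B b.
    apply: contrapT => Bb; case: (Mmax B).
      split=> [x Mx|le]; first by exists 0; rewrite scale0r subr0.
      by apply/Mv/le; exists 1; rewrite scale1r subrr.
    split=> // k x y [c Mx] [d My]; exists (k * c + d).
    rewrite scalerDl opprD addrACA -scalerA -scalerBr.
    exact: Mlin.
  case=> c Mc; have [c0|c0] := eqVneq c 0.
    by move: Mc; rewrite c0 scale0r subr0.
  exists c^-1; rewrite -[v in v - _]scale1r -(mulVf c0) -scalerA -scalerBr.
  by apply: (MZ); rewrite -opprB -scaleN1r; apply: MZ.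
have coord_uniq v c d : M (v - c *: b) -> M (v - d *: b) -> c = d.
  move=> Mc Md; apply/eqP; rewrite -subr_eq0; apply: contrapT => /negP cd.
  have := MB _ _ Md Mc; rewrite opprB addrC addrA subrK -scalerBl.
  by move/(MZ (c - d)^-1); rewrite scalerA mulVf // scale1r.
have [f Mf] := choice coord_ex; exists f => [k x y|].
  apply: (coord_uniq (k *: x + y)) (Mf _) _.
  by rewrite scalerDl opprD addrACA -scalerA -scalerBr; apply: Mlin.
by apply: (coord_uniq b) (Mf b) _; rewrite scale1r subrr.
Qed.
End LinearForm.

Lemma linearZE (K : fieldType) (U W : lmodType K) (h : U -> W) c u :
  linear h -> h (c *: u) = c *: h u.
Proof. by move=> lh; rewrite -[c *: u]addr0 lh (linear0E lh) addr0. Qed.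

Lemma linearDE (K : fieldType) (U W : lmodType K) (h : U -> W) u v :
  linear h -> h (u + v) = h u + h v.
Proof. by move=> lh; rewrite -[u]scale1r lh !scale1r. Qed.

Lemma linearBE (K : fieldType) (U W : lmodType K) (h : U -> W) u v :
  linear h -> h (u - v) = h u - h v.
Proof. by move=> lh; rewrite addrC -scaleN1r lh scaleN1r addrC. Qed.

Lemma linear_scalel (K : fieldType) (U W : lmodType K) (k : U -> K) (w : W) :
  linear (k : U -> K^o) -> linear (fun u => k u *: w).
Proof. by move=> lk c x y; rewrite lk scalerDl scalerA. Qed.

Section TreeSpace.
Context {K : fieldType} {E V : lmodType K}.
Local Notation T := (tree_space E V).
Local Notation tg := (@tree_gen K E V).
Local Notation root b := (tg (Root b)).

(** * Maps out of the tree space *)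

Lemma tree_space_ext (W : lmodType K) (f h : T -> W) : linear f -> linear h ->
    (forall b, f (root b) = h (root b)) ->
    (forall a y z, f y = h y -> f z = h z ->
       f (graft_op a y z) = h (graft_op a y z)) ->
  f =1 h.
Proof.
move=> lf lh fh_root fh_graft; apply: presented_ext => //.
elim=> [b|a s IHs t IHt]; first exact: fh_root.
by have := fh_graft a _ _ IHs IHt; rewrite graft_op_gen.
Qed.

(* The universal property of the tree space as the sum of V and of the        *)
(* quotient of E (x) T (x) T by the exchange of branches.                     *)
Lemma tree_space_univ (W : lmodType K) (r : V -> W) (H : E -> T -> T -> W) :
    linear r -> (forall x y, linear (fun a => H a x y)) ->
    (forall a y, linear (fun x => H a x y)) -> (forall a x, linear (H a x)) ->
    (forall a a' x y z,
       H a x (graft_op a' y z) = H a' y (graft_op a x z)) ->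
  exists F : T -> W, [/\ linear F, forall b, F (root b) = r b
    & forall a x y, F (graft_op a x y) = H a x y].
Proof.
move=> rlin Hlin Hlinl Hlinr HC.
pose f t := match t with Root b => r b | Graft a s t => H a (tg s) (tg t) end.
have fR : respects (@tree_rel K E V) f.
  apply: tree_respects => [[b0 v|a s t [v|v]]|[b0 []|a s t [u|[e|e]]]|t t'] //=.
  - exact: linear_comp (Hlinl _ _) (tree_gen_vertex v).
  - exact: linear_comp (Hlinr _ _) (tree_gen_vertex v).
  - exact: linear_comp (Hlinl _ _) (tree_gen_edge e).
  - exact: linear_comp (Hlinr _ _) (tree_gen_edge e).
  elim=> [b|a s s' {}t {}t' ss' _ tt' _|a s a' s' {}t|t1 t2 t3 _ IH1 _ IH2] //=.
  - by rewrite (tree_gen_iso ss') (tree_gen_iso tt').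
  - by rewrite -!graft_op_gen HC.
  - by rewrite IH1.
exists (plift f); split=> [|b|a]; first exact: plift_linear.
  exact: plift_gen.
have Flin : linear (plift f : T -> W) by apply: plift_linear.
move=> x y; move: x; apply: presented_ext => [||s]; first 2 last.
- move: y; apply: presented_ext => [||t]; first 2 last.
  + by rewrite graft_op_gen; apply: (plift_gen _ fR).
  + exact: linear_comp Flin (graft_op_linearr _ _).
  + exact: Hlinr.
- exact: linear_comp Flin (graft_op_linearl _ _).
- exact: Hlinl.
Qed.

Lemma flip12_linear : linear (@flip12 K E V).
Proof.
pose sw : {linear tensor E E -> tensor E E} := HB.pack (@tens_swap _ E E)
  (GRing.isLinear.Build K _ _ _ (@tens_swap _ E E)
     (tlift_linear (tens_swap_bilin E E))).
apply: linear_comp; last exact: (tlift_linear (tens_unassoc_bilin E E V).2).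
apply: linear_comp; first exact: (tlift_linear (tens_assoc_bilin E E V).2).
exact: (tlift_linear (tens_map_bilin sw (@idfun V))).
Qed.

Lemma tens2_ext (W : lmodType K) (f h : tensor E (tensor E V) -> W) :
    linear f -> linear h ->
    (forall a a' b, f (tens a (tens a' b)) = h (tens a (tens a' b))) ->
  f =1 h.
Proof.
move=> lf lh fh; apply: tensor_ext => // a.
have tr := (tens_bilin E (tensor E V)).2 a.
apply: tensor_ext => [||a' b]; last exact: fh.
  exact: linear_comp lf tr.
exact: linear_comp lh tr.
Qed.

Lemma flip12K : involutive (@flip12 K E V).
Proof.
apply: tens2_ext => // [|a a' b]; last by rewrite !flip12E.
exact: linear_comp flip12_linear flip12_linear.
Qed.

(** * Grafting one or two trees on a single vertex *)

Definition graft_root (x : T) : tensor E V -> T :=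
  tlift (fun a b => graft_op a x (root b)).

Lemma graft_root_linear x : linear (graft_root x).
Proof. exact/tlift_linear/graft_root_bilin. Qed.

Lemma graft_rootE x a b : graft_root x (tens a b) = graft_op a x (root b).
Proof. exact: (tlift_tens _ _ (graft_root_bilin x)). Qed.

Lemma graft_root_linearl u : linear (graft_root^~ u).
Proof.
move=> c x y; move: u; apply: tensor_ext => [||a b].
- exact: graft_root_linear.
- exact/linear_comb/graft_root_linear/graft_root_linear.
by rewrite !graft_rootE graft_op_linearl.
Qed.

Definition graft_root2 (x y : T) : tensor E (tensor E V) -> T :=
  tlift (fun a u => graft_op a x (graft_root y u)).

Lemma graft_root2_bilin x y :
  bilin (fun a u => graft_op a x (graft_root y u)).
Proof.
split=> [u|a]; first exact: graft_op_linear.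
exact: linear_comp (graft_op_linearr a x) (graft_root_linear y).
Qed.

Lemma graft_root2_linear x y : linear (graft_root2 x y).
Proof. exact/tlift_linear/graft_root2_bilin. Qed.

Lemma graft_root2E x y a u :
  graft_root2 x y (tens a u) = graft_op a x (graft_root y u).
Proof. exact: (tlift_tens _ _ (graft_root2_bilin x y)). Qed.

(** The branches at a root are unordered, so exchanging their edge decorations amounts to exchanging
    the trees. *)
Lemma graft_root2C x y w : graft_root2 x y (flip12 w) = graft_root2 y x w.
Proof.
move: w; apply: tens2_ext => [||a a' b].
- exact: linear_comp (graft_root2_linear x y) flip12_linear.
- exact: graft_root2_linear.
by rewrite flip12E !graft_root2E !graft_rootE graft_opC.
Qed.

(* A retraction of graft_root2 x y, where x is a vertex and y an edge with    *)
(* its two vertices: on a root with two branches, a linear form which is 1 at *)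
(* x and 0 at y and a linear form which is 0 at x and 1 at y single out the   *)
(* branches.                                                                  *)
Lemma graft_root2_inj (a0 : E) (b0 : V) : a0 != 0 -> b0 != 0 ->
  exists x y, injective (graft_root2 x y).
Proof.
move=> /exists_linear_form [g glin ga0] /exists_linear_form [f flin fb0].
have [tl tr] := @tens_bilin _ E V.
have [tl2 tr2] := @tens_bilin _ E (tensor E V).
have [rho [rho_lin rhoR rhoG]] : exists rho : T -> V, [/\ linear rho,
    forall b, rho (root b) = b & forall a x y, rho (graft_op a x y) = 0].
  by apply: (@tree_space_univ V id (fun _ _ _ => 0)) => // *; apply: linear_zero.
(* [lam] detects a single vertex; [mu] below detects a single edge with two vertices. *)
pose lam : T -> K := f \o rho.
have lam_lin : linear (lam : T -> K^o) by exact: linear_comp flin rho_lin.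
have lamR b : lam (root b) = f b by rewrite /lam /= rhoR.
have lamG a x y : lam (graft_op a x y) = 0.
  by rewrite /lam /= rhoG; apply: (linear0E flin).
have [mu [mu_lin muR muG]] : exists mu : T -> K,
    [/\ linear (mu : T -> K^o), forall b, mu (root b) = 0
    & forall a x y, mu (graft_op a x y) = lam y *: (lam x *: (g a : K^o))].
  apply: (@tree_space_univ K^o (fun=> 0)) => [|x y|a y|a x|a a' x y z].
  - exact: linear_zero.
  - exact/linear_scale/linear_scale.
  - exact/linear_scale/linear_scalel.
  - exact: linear_scalel.
  - by rewrite (lamG a' y z) (lamG a x z) !scale0r.
have theta (k : T -> K) : linear (k : T -> K^o) -> exists F : T -> tensor E V,
    [/\ linear F, forall b, F (root b) = 0
      & forall a x y, F (graft_op a x y) = k x *: tens a (rho y)].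
  move=> klin; apply: tree_space_univ => [|x y|a y|a x|a a' x y z].
  - exact: linear_zero.
  - exact/linear_scale/tl.
  - exact: linear_scalel.
  - apply: linear_scale; exact: linear_comp (tr a) rho_lin.
  - by rewrite !rhoG !(linear0E (tr _)) !scaler0.
have [thm [thm_lin _ thmG]] := theta _ mu_lin.
have [thl [thl_lin _ thlG]] := theta _ lam_lin.
(* The outer branch is read as [x] in the first term and as [y] in the second, which makes [F]
   invariant under exchange of branches. *)
have [F [Flin _ FG]] : exists F : T -> tensor E (tensor E V), [/\ linear F,
    forall b, F (root b) = 0
    & forall a x y, F (graft_op a x y)
        = lam x *: tens a (thm y) + mu x *: flip12 (tens a (thl y))].
  have flin2 a : linear (fun u : tensor E V => flip12 (tens a u)).
    exact: linear_comp flip12_linear (tr2 a).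
  apply: tree_space_univ => [|x y|a y|a x|a a' x y z].
  - exact: linear_zero.
  - apply: linear_add; apply: linear_scale; first exact: tl2.
    exact: linear_comp flip12_linear (tl2 _).
  - by apply: linear_add; apply: linear_scalel.
  - apply: linear_add; apply: linear_scale; first exact: linear_comp (tr2 a) _.
    exact: linear_comp (flin2 a) _.
  rewrite !thmG !thlG !(linearZE _ _ (tr2 _)) !(linearZE _ _ flip12_linear).
  by rewrite !flip12E !scalerA addrC [mu x * _]mulrC [mu y * _]mulrC.
(* Equal trees would not do in general: [graft_root2 x x] is invariant under [flip12]. *)
exists (root b0), (graft_op a0 (root b0) (root b0)).
apply: (can_inj (g := F)); apply: tens2_ext => [|//|a a' b].
  exact/linear_comp/graft_root2_linear.
rewrite graft_root2E graft_rootE FG lamR fb0 scale1r muR scale0r addr0.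
by rewrite thmG muG ga0 lamR fb0 !scale1r rhoR.
Qed.

(** * The product as a derivation, and its iterates *)

Variable phi : {linear tensor E V -> tensor E V}.
Local Notation L := (tree_prelie phi).
Local Notation phi13 := (phi13 phi).
Local Notation phi23 := (phi23 phi).

Lemma tree_prelie_root a x b : L a x (root b) = graft_root x (phi (tens a b)).
Proof.
have [_ ll _] := tree_prelie_trilinear phi.
move: x; apply: presented_ext => [||s].
- exact: ll.
- exact: graft_root_linearl.
by rewrite [LHS]tree_prelie_gen graft_sum_root.
Qed.

(** Leibniz rule: each vertex of the grafted tree comes from either [y] or [z]. *)
Lemma tree_prelie_graft a x a' y z :
  L a x (graft_op a' y z) = graft_op a' (L a x y) z + graft_op a' y (L a x z).
Proof.
have [_ ll lr] := tree_prelie_trilinear phi.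
move: x; apply: presented_ext => [||s].
- exact: ll.
- apply: linear_add; first exact: linear_comp (graft_op_linearl _ _) (ll _ _).
  exact: linear_comp (graft_op_linearr _ _) (ll _ _).
move: y; apply: presented_ext => [||t1].
- exact: linear_comp (lr _ _) (graft_op_linearl _ _).
- apply: linear_add; last exact: graft_op_linearl.
  exact: linear_comp (graft_op_linearl _ _) (lr _ _).
move: z; apply: presented_ext => [||t2].
- exact: linear_comp (lr _ _) (graft_op_linearr _ _).
- apply: linear_add; first exact: graft_op_linearr.
  exact: linear_comp (graft_op_linearr _ _) (lr _ _).
rewrite -![gen _ _]/(tg _) graft_op_gen !tree_prelie_gen.
exact: graft_sum_graft.
Qed.

Lemma phi23_linear : linear phi23.
Proof. exact: (tlift_linear (tens_map_bilin (@idfun E) phi)). Qed.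

Lemma phi23E a u : phi23 (tens a u) = tens a (phi u).
Proof. exact: (tens_mapE (@idfun E) phi). Qed.

Lemma phi13_linear : linear phi13.
Proof.
apply: linear_comp flip12_linear; apply: linear_comp phi23_linear.
exact: flip12_linear.
Qed.

(** Either [x] lands in [y], or it lands on the root; then [phi] acts on the new edge and the root
    and skips the edge to [y], whence [phi13]. *)
Lemma tree_prelie_graft_root a x y u :
  L a x (graft_root y u)
    = graft_root (L a x y) u + graft_root2 x y (phi13 (tens a u)).
Proof.
have [_ _ lr] := tree_prelie_trilinear phi.
have tr2 := (tens_bilin E (tensor E V)).2.
move: u; apply: tensor_ext => [||a' b].
- exact: linear_comp (lr _ _) (graft_root_linear y).
- apply: linear_add; first exact: graft_root_linear.
  apply: linear_comp (graft_root2_linear x y) _.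
  exact: linear_comp phi13_linear (tr2 a).
rewrite graft_rootE tree_prelie_graft graft_rootE tree_prelie_root.
by rewrite /phi13 /= flip12E phi23E graft_root2C graft_root2E.
Qed.

Lemma tree_prelie2_root a a' x y b :
  L a x (L a' y (root b)) - L a' (L a x y) (root b)
    = graft_root2 x y (phi13 (phi23 (tens a (tens a' b)))).
Proof.
by rewrite !tree_prelie_root tree_prelie_graft_root addrC addKr phi23E.
Qed.

Lemma tree_prelie2_rootC a a' x y b :
  L a' y (L a x (root b)) - L a (L a' y x) (root b)
    = graft_root2 x y (phi23 (phi13 (tens a (tens a' b)))).
Proof.
(* Conjugation by [flip12] interchanges [phi13] and [phi23]. *)
by rewrite tree_prelie2_root -graft_root2C /phi13 /= flip12K -(flip12E a a').
Qed.

(* Iterating the derivations adds cross terms, symmetric in (a, x), (a', y).  *)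
Lemma tree_prelie2_graft a a' x y b z t :
  L a x (L a' y (graft_op b z t)) - L a' (L a x y) (graft_op b z t)
    = graft_op b (L a x (L a' y z) - L a' (L a x y) z) t
      + graft_op b z (L a x (L a' y t) - L a' (L a x y) t)
      + (graft_op b (L a x z) (L a' y t) + graft_op b (L a' y z) (L a x t)).
Proof.
have [_ _ lr] := tree_prelie_trilinear phi.
rewrite !tree_prelie_graft (linearDE _ _ (lr _ _)) !tree_prelie_graft.
rewrite (linearBE _ _ (graft_op_linearl b t)).
rewrite (linearBE _ _ (graft_op_linearr b z)) opprD.
rewrite [X in _ = X + _]addrACA [X in _ = X]addrAC; congr (_ + _).
rewrite -[LHS]addrA -[RHS]addrA; congr (_ + _).
by rewrite [LHS]addrC -[LHS]addrA [LHS]addrCA.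
Qed.

End TreeSpace.

(** * The equivalence *)

Theorem theorem3p3 (K : fieldType) (hK : [pchar K] =i pred0)
  (DE DV : lmodType K)
  (hE : exists a : DE, a != 0) (hV : exists b : DV, b != 0)
  (phi : {linear tensor DE DV -> tensor DE DV}) :
  multiple_prelie (tree_prelie phi) <-> tree_compatible phi.
Proof.
have [_ _ lr] := tree_prelie_trilinear phi.
split=> [[_ prelie]|compat].
  have [[a0 a0P] [b0 b0P]] := (hE, hV).
  have [x [y xy_inj]] := graft_root2_inj a0P b0P.
  apply: tens2_ext => [||a a' b].
  - exact: linear_comp (phi13_linear phi) (phi23_linear phi).
  - exact: linear_comp (phi23_linear phi) (phi13_linear phi).
  apply: xy_inj; rewrite /= -tree_prelie2_root -tree_prelie2_rootC.
  exact: prelie.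
split=> [|a a' x y]; first exact: tree_prelie_trilinear.
have defect_linear b b' u v w : linear (fun z =>
    tree_prelie phi b u (tree_prelie phi b' v z) - tree_prelie phi b' w z).
  by move=> c z z'; rewrite !lr scalerBr opprD addrACA.
apply: tree_space_ext => [||b|b y' z' IHy IHz] //.
- rewrite tree_prelie2_root tree_prelie2_rootC; congr graft_root2.
  exact: compat.
(* The two sides now differ only in the order of the two cross terms. *)
by rewrite !tree_prelie2_graft IHy IHz; congr (_ + _); rewrite addrC.
Qed.
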